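(* Every complete separable ultrahomogeneous metric space $\mathbf{Y}$ includes a countable ultrahomogeneous dense metric subspace.
   Context: A metric space $\mathbf{X}$ is ultrahomogeneous when every isometry between finite metric subspaces of $\mathbf{X}$ can be extended to an isometry of $\mathbf{X}$ onto itself. *)

(* Defs.v *)
From HB Require Import structures.
From mathcomp Require Import all_boot all_order all_algebra.
From mathcomp Require Import all_classical all_reals all_analysis.

Set Implicit Arguments.
Unset Strict Implicit.
Unset Printing Implicit Defensive.

Import Order.TTheory GRing.Theory Num.Theory.

Local Open Scope classical_set_scope.
Local Open Scope ring_scope.

(* A metric subspace of T is a set A : set T with the induced distance; T itself
   is [set: T]. A map between subspaces is given by a total map T -> T, of which
   only the restriction to the source matters. *)

(* Isometries are onto; injectivity follows from the preservation of mdist. *)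
Definition isometry_onto (R : realType) (T : metricType R) (A B : set T)
    (f : T -> T) : Prop :=
  f @` A = B /\ forall x y, A x -> A y -> mdist (f x) (f y) = mdist x y.

Definition ultrahomogeneous (R : realType) (T : metricType R) (X : set T)
    : Prop :=
  forall (A B : set T) (f : T -> T),
    A `<=` X -> B `<=` X -> finite_set A -> finite_set B ->
    isometry_onto A B f ->
    exists g : T -> T,
      isometry_onto X X g /\ forall x, A x -> g x = f x.

(* completeType is not used because it requires the space to be pointed, hence
   nonempty. *)
Definition complete_metric (R : realType) (T : metricType R) : Prop :=
  forall u : nat -> T, cauchy (u @ \oo) -> exists l : T, u @ \oo --> l.

Definition separable (T : topologicalType) : Prop :=
  exists D : set T, countable D /\ dense D.

(* Main.v *)
(* As in the downward Löwenheim-Skolem theorem: choose, for every finite partial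
   isometry of Y, an extension to an isometry of Y together with its inverse, and
   close a countable dense set under all the chosen maps whose partial isometry
   lives on points already obtained.  The points of the closure are named by finite
   trees, hence countable, and the chosen extensions restrict to bijections of it. *)
Require Import Defs.
From HB Require Import structures.
From mathcomp Require Import all_boot all_order all_algebra.
From mathcomp Require Import all_classical all_reals all_analysis.

Local Open Scope classical_set_scope.

Lemma isometry_onto_setT_inverse (R : realType) (T : metricType R) (g : T -> T) :
  isometry_onto [set: T] [set: T] g -> exists h, cancel g h /\ cancel h g.
Proof.
move=> [gT g_iso].
have /choice[h gK] (y : T) : exists x, g x = y.
  have [x _ <-] : (g @` [set: T]) y by rewrite gT.
  by exists x.
exists h; split=> // x; apply: mdist_positivity.
by rewrite -g_iso// gK mdistxx.
Qed.

(** A finite partial isometry is coded by the list of its arguments and the list of its values, so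
    that the children of a tree node can spell it out. *)
Definition extends (R : realType) (T : metricType R) (a b : seq T)
    (gh : (T -> T) * (T -> T)) : Prop :=
  [/\ isometry_onto [set: T] [set: T] gh.1, cancel gh.1 gh.2, cancel gh.2 gh.1
    & map gh.1 a = b].

Lemma extension_choice (R : realType) (T : metricType R) :
  exists E : seq T * seq T -> (T -> T) * (T -> T),
    forall a b gh, extends R T a b gh -> extends R T a b (E (a, b)).
Proof.
have /choice[E EP] (ab : seq T * seq T) : exists gh',
    forall gh, extends R T ab.1 ab.2 gh -> extends R T ab.1 ab.2 gh'.
  have [[gh ghP]|no] := pselect (exists gh, extends R T ab.1 ab.2 gh).
    by exists gh.
  by exists (id, id) => gh ghP; case: no; exists gh.
by exists E => a b; apply: (EP (a, b)).
Qed.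

(* A node [k] with children [x :: a ++ b], where [size a = k./2], names the image of
   [x] under the extension chosen for [a |-> b], or under its inverse if [k] is
   odd. *)
Fixpoint tree_point (T : Type) (E : seq T * seq T -> (T -> T) * (T -> T))
    (d : nat -> T) (t : GenTree.tree nat) : T :=
  match t with
  | GenTree.Leaf n => d n
  | GenTree.Node k ts =>
    if map (tree_point T E d) ts is x :: l then
      let gh := E (take k./2 l, drop k./2 l) in
      if odd k then gh.2 x else gh.1 x
    else d 0%N
  end.

(** The witness is a node over [t :: ts ++ us]: half its label tells where to cut the list, its
    parity selects the map or the inverse. *)
Lemma tree_point_closed (T : Type) (E : seq T * seq T -> (T -> T) * (T -> T))
    (d : nat -> T) (ts us : seq (GenTree.tree nat)) (t : GenTree.tree nat) :
  let p := tree_point T E d in let gh := E (map p ts, map p us) in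
  range p (gh.1 (p t)) /\ range p (gh.2 (p t)).
Proof.
move=> p gh; split.
- exists (GenTree.Node (size ts).*2 (t :: ts ++ us)) => //.
  by rewrite /p /= odd_double doubleK map_cat take_size_cat ?drop_size_cat ?size_map.
- exists (GenTree.Node (size ts).*2.+1 (t :: ts ++ us)) => //.
  rewrite /p /= odd_double /= uphalf_double map_cat.
  by rewrite take_size_cat ?drop_size_cat ?size_map.
Qed.

Lemma ultrahomogeneous_tree_points (R : realType) (T : metricType R)
    (E : seq T * seq T -> (T -> T) * (T -> T)) (d : nat -> T) :
  (forall a b gh, extends R T a b gh -> extends R T a b (E (a, b))) ->
  ultrahomogeneous [set: T] -> ultrahomogeneous (range (tree_point T E d)).
Proof.
move=> EP homT A B f AX BX finA finB f_iso.
set p := tree_point T E d in AX BX *.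
have [g [g_iso gf]] := homT A B f (@subsetT _ _) (@subsetT _ _) finA finB f_iso.
have [h [gK hK]] := isometry_onto_setT_inverse R T g g_iso.
have /finite_seqP[a Aa] := finA.
have /choice[c cP] (x : T) : exists t, range p x -> p t = x.
  have [[t _ <-]|no] := pselect (range p x); first by exists t.
  by exists (GenTree.Leaf 0%N).
have pa : map p (map c a) = a.
  rewrite -map_comp -[RHS]map_id; apply/eq_in_map => x xa /=.
  by apply/cP/AX; rewrite Aa.
have pfa : map p (map c (map f a)) = map f a.
  rewrite -map_comp -[RHS]map_id; apply/eq_in_map => _ /mapP[x xa ->] /=.
  by apply/cP/BX; case: f_iso => <- _; exists x; rewrite // Aa.
(* [g] need not preserve [range p]; it only shows that an extension exists, so that the chosen pair
   [gh] extends [f] as well. *)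
have : extends R T a (map f a) (g, h).
  by split=> //; apply/eq_in_map => x xa; apply: gf; rewrite Aa.
move=> /EP[]; set gh := E _ => -[_ gh_iso] ghK hgK mapf.
have closed t : range p (gh.1 (p t)) /\ range p (gh.2 (p t)).
  have := tree_point_closed T E d (map c a) (map c (map f a)) t.
  by rewrite /= -/p pa pfa.
exists gh.1; split; [split|].
(* Closure under [gh.1] keeps the image inside; closure under [gh.2] supplies the preimages. *)
- apply/seteqP; split=> [_ [_ [t _ <-] <-]|_ [t _ <-]].
    exact: (closed t).1.
  by exists (gh.2 (p t)); [exact: (closed t).2|exact: hgK].
- by move=> x y _ _; apply: gh_iso.
- by move=> x; rewrite Aa => xa; apply: (eq_in_map _ _ _).2 xa.
Qed.

Theorem theorem1 (R : realType) (Y : metricType R) :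
  complete_metric Y -> separable Y -> ultrahomogeneous [set: Y] ->
  exists X : set Y, countable X /\ ultrahomogeneous X /\ dense X.
Proof.
move=> _ [D [cD dD]] homY.
(* An enumeration [nat -> Y] needs a point, so the empty [D] is treated apart and serves as [X]
   itself. *)
have [D0|/set0P D_neq0] := eqVneq D set0.
  exists D; split=> //; split=> // A B f; rewrite D0 => A0 _ _ _ _.
  exists id; split; last by move=> x /A0.
  by split; [rewrite image_set0|].
have [d Dd] : exists d : nat -> Y, D `<=` range d.
  have [y0 _] := D_neq0.
  have /countable_injP[i i_inj] := cD.
  have /choice[d dP] (n : nat) : exists y, forall x, D x -> i x = n -> x = y.
    have [[y [Dy yn]]|no] := pselect (exists y, D y /\ i y = n).
      by exists y => x Dx xn; apply: i_inj; rewrite ?inE// xn.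
    by exists y0 => x Dx xn; case: no; exists x.
  by exists d => x Dx; exists (i x) => //; rewrite -(dP (i x) x).
have [E EP] := extension_choice R Y.
exists (range (tree_point Y E d)); split; first exact: (card_le_trans (card_image_le _ _) (countableP _)).
split; first exact: ultrahomogeneous_tree_points.
(* Leaves name all points of [D], so density is inherited. *)
move=> O O0 oO; have [y [Oy Dy]] := dD O O0 oO.
by exists y; split=> //; have [n _ <-] := Dd y Dy; exists (GenTree.Leaf n).
Qed.
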